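(* The HausLip constant is an invariant of topological conjugacy and is bounded below by the topological entropy. That is: (i) if $X,Y$ are compact metrizable spaces, $f:X\to X$ and $g:Y\to Y$ are continuous maps, and there is a homeomorphism $\psi:X\to Y$ with $g\circ\psi=\psi\circ f$, then $\mathrm{HausLip}(X,f)=\mathrm{HausLip}(Y,g)$; (ii) for every compact metrizable space $X$ and continuous map $f:X\to X$, $\mathrm{HausLip}(X,f)\geq h(f)$, where $h(f)$ is the topological entropy of $f$.
   Context: Let $X$ be a compact metrizable space and $f:X\to X$ a continuous map. A metric $d:X\times X\to[0,\infty)$ is compatible if the topology it induces coincides with the topology of $X$; $\mathcal{D}(X)$ denotes the set of all compatible metrics on $X$. For $d\in\mathcal{D}(X)$, the Lipschitz constant is $\mathrm{Lip}_d(f)=\sup_{0<d(x,y)} \frac{d(f(x),f(y))}{d(x,y)}\in[0,\infty]$ (supremum taken in $[0,\infty]$; the value $\infty$ means $f$ is not Lipschitz with respect to $d$). $\mathrm{HD}_d(X)\in[0,\infty]$ is the usual Hausdorff dimension of the metric space $(X,d)$. We write $\log^+(y)=\max(\log y,0)$, with $\log^+ 0=0$ and $\log^+\infty=\infty$. The HausLip constant of the system $(X,f)$ is $$\mathrm{HausLip}(X,f)=\inf_{d\in\mathcal{D}(X)} \mathrm{HD}_d(X)\cdot\log^+\mathrm{Lip}_d(f)\in[0,\infty],$$ with the convention $0\cdot\infty=\infty\cdot 0=\infty$ (so metrics for which $f$ is not Lipschitz or $X$ has infinite Hausdorff dimension are effectively ignored). *)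

(* Defs.v *)
(* Metrics are functions X -> X -> R, so that the infimum
   over all compatible metrics is taken on one fixed topological space.
   Spaces are allowed to be empty. *)
From HB Require Import structures.
From mathcomp Require Import all_boot all_order all_algebra.
From mathcomp Require Import all_classical all_reals all_analysis.
Set Implicit Arguments.
Unset Strict Implicit.
Unset Printing Implicit Defensive.
Import Order.TTheory GRing.Theory Num.Theory.
Local Open Scope classical_set_scope.
Local Open Scope ring_scope.
Local Open Scope ereal_scope.

Definition is_metric (R : realType) (X : Type) (d : X -> X -> R) : Prop :=
  [/\ forall x y, (0 <= d x y)%R,
      forall x y, d x y = 0%R <-> x = y,
      forall x y, d x y = d y x &
      forall x y z, (d x z <= d x y + d y z)%R].

Definition compatible_metric (R : realType) (X : topologicalType)
    (d : X -> X -> R) : Prop :=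
  is_metric d /\
  forall A : set X, open A <->
    (forall x, A x -> exists2 e : R, (0 < e)%R & forall y, (d x y < e)%R -> A y).

Definition metrizable (R : realType) (X : topologicalType) : Prop :=
  exists d : X -> X -> R, compatible_metric d.

Definition homeomorphism (X Y : topologicalType) (psi : X -> Y) : Prop :=
  continuous psi /\
  exists phi : Y -> X, [/\ cancel psi phi, cancel phi psi & continuous phi].

(* The maximum with 0 only matters when X has at most one point: the supremum
   in [0, +oo] of the empty set is 0, while ereal_sup set0 = -oo. *)
Definition Lip (R : realType) (X : Type) (d : X -> X -> R) (f : X -> X)
    : \bar R :=
  maxe 0 (ereal_sup [set (d (f p.1) (f p.2) / d p.1 p.2)%:E
                    | p in [set p : X * X | (0 < d p.1 p.2)%R]]).

(* The maximum with 0 only matters for U = set0. *)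
Definition diam (R : realType) (X : Type) (d : X -> X -> R) (U : set X)
    : \bar R :=
  maxe 0 (ereal_sup [set (d p.1 p.2)%:E | p in U `*` U]).

(* diam(U)^s; the empty set weighs 0 for every s, and 0 `^ 0 = 1 for a
   singleton, so that s = 0 gives the counting measure. *)
Definition diam_pow (R : realType) (X : Type) (d : X -> X -> R) (s : R)
    (U : set X) : \bar R :=
  if U == set0 then 0 else diam d U `^ s.

Definition hausdorff_premeasure (R : realType) (X : Type) (d : X -> X -> R)
    (s delta : R) (A : set X) : \bar R :=
  ereal_inf [set \sum_(0 <= i <oo) diam_pow d s (U i)
            | U in [set U : nat -> set X |
                A `<=` \bigcup_i U i /\ forall i, diam d (U i) <= delta%:E]].

Definition hausdorff_measure (R : realType) (X : Type) (d : X -> X -> R)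
    (s : R) (A : set X) : \bar R :=
  ereal_sup [set hausdorff_premeasure d s delta A
            | delta in [set delta : R | (0 < delta)%R]].

Definition hausdorff_dim (R : realType) (X : Type) (d : X -> X -> R)
    (A : set X) : \bar R :=
  ereal_inf [set s%:E
            | s in [set s : R | (0 <= s)%R /\ hausdorff_measure d s A = 0]].

(* lne 0 = -oo and lne +oo = +oo. *)
Definition logp (R : realType) (x : \bar R) : \bar R := maxe (lne x) 0.

(* Product on [0, +oo] with 0 * oo = oo * 0 = oo (the library has 0 * oo = 0). *)
Definition mul_infty (R : realType) (x y : \bar R) : \bar R :=
  if (x == +oo) || (y == +oo) then +oo else x * y.

Definition HausLip (R : realType) (X : topologicalType) (f : X -> X)
    : \bar R :=
  ereal_inf [set mul_infty (hausdorff_dim d [set: X]) (logp (Lip d f))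
            | d in [set d : X -> X -> R | compatible_metric d]].

(* Topological entropy by open covers (Adler, Konheim and McAndrew). *)

Definition covering (X : Type) (U : set (set X)) : Prop :=
  \bigcup_(A in U) A = [set: X].

Definition open_covering (X : topologicalType) (U : set (set X)) : Prop :=
  (forall A, U A -> open A) /\ covering U.

(* Least cardinality of a finite subcover. *)
Definition min_subcover (R : realType) (X : Type) (U : set (set X)) : \bar R :=
  ereal_inf [set (n%:R : R)%:E
            | n in [set n : nat | exists V : set (set X),
                [/\ V `<=` U, (V #= `I_n)%card & covering V]]].

(* The common refinement of U, f^-1 U, ..., f^-(n-1) U. *)
Definition join_iter (X : Type) (f : X -> X) (U : set (set X)) (n : nat)
    : set (set X) :=
  [set \bigcap_(i in `I_n) (iter i f @^-1` (c i))
  | c in [set c : nat -> set X | forall i, (i < n)%N -> U (c i)]].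

(* The sequence converges by subadditivity, so the upper limit is the limit.
   logp differs from lne only when the minimal cardinality is 0, i.e., when X
   is empty, where it makes the entropy 0. *)
Definition cover_entropy (R : realType) (X : Type) (f : X -> X)
    (U : set (set X)) : \bar R :=
  limn_esup (fun n => ((n%:R)^-1)%:E * logp (min_subcover R (join_iter f U n))).

Definition top_entropy (R : realType) (X : topologicalType) (f : X -> X)
    : \bar R :=
  ereal_sup [set cover_entropy R f U
            | U in [set U : set (set X) | open_covering U]].

(* Main.v *)
(* Invariance: a homeomorphism pulls compatible metrics back to compatible
   metrics with the same Lipschitz constant and Hausdorff dimension.

   Lower bound: fix a compatible metric d, an open cover with Lebesgue number e,
   some L > 1 with Lip_d f <= L, and s with H^s(X) = 0. A set of diameter r lies
   in an element of the n-th join as soon as L^(n-1) r < e; for the largest such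
   n, L^(-s n) <= (r/e)^s. As H^s(X) = 0 and X is compact, finitely many elements
   A_i of joins of orders n_i cover X, with sum_i L^(-s n_i) <= 1. Following
   orbits through the A_i (Bowen's argument) gives subcovers of the N-th join of
   size O(L^(s N)), so that the entropy is at most s log L. *)
Require Import Defs.
From HB Require Import structures.
From mathcomp Require Import all_boot all_order all_algebra.
From mathcomp Require Import finmap.
From mathcomp Require Import all_classical all_reals all_analysis.
From mathcomp Require Import lra.
Set Implicit Arguments.
Unset Strict Implicit.
Unset Printing Implicit Defensive.
Import Order.TTheory GRing.Theory Num.Theory.
Local Open Scope classical_set_scope.
Local Open Scope ring_scope.
Local Open Scope ereal_scope.

(** * Iterated joins, compactness and counting of subcovers *)

Lemma subset_join_iter (X : Type) (f : X -> X) (U : set (set X)) (k n : nat)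
    (A : set X) :
  (k <= n)%N -> join_iter f U n A -> exists2 B, join_iter f U k B & A `<=` B.
Proof.
move=> kn [c Uc <-]; exists (\bigcap_(i in `I_k) (iter i f @^-1` c i)).
  by exists c => // i ik; apply: Uc; exact: leq_trans ik kn.
by move=> x Ax i /= ik; apply: Ax => /=; exact: leq_trans ik kn.
Qed.

Lemma join_iterD (X : Type) (f : X -> X) (U : set (set X)) (n m : nat)
    (A B : set X) :
  join_iter f U n A -> join_iter f U m B ->
  join_iter f U (n + m) (A `&` iter n f @^-1` B).
Proof.
move=> [a Ua <-] [b Ub <-].
exists (fun i => if (i < n)%N then a i else b (i - n)%N).
  move=> i inm; case: ltnP => [/Ua//|ni].
  by apply: Ub; rewrite ltn_subLR.
apply/seteqP; split=> [x cx|x [ax bx] i /= inm].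
  split=> i /= hi.
    by have := cx i; rewrite /= hi; apply; apply: leq_trans hi (leq_addr _ _).
  have := cx (n + i)%N; rewrite /= ltn_add2l hi => /(_ isT).
  by rewrite ltnNge leq_addr /= addKn addnC iterD.
case: ltnP => [/ax//|ni].
by have := bx (i - n)%N; rewrite /= ltn_subLR // => /(_ inm); rewrite -iterD subnK.
Qed.

Lemma join_iter_open (X : topologicalType) (f : X -> X) (U : set (set X))
    (n : nat) (A : set X) :
  continuous f -> (forall B, U B -> open B) -> join_iter f U n A -> open A.
Proof.
move=> cf Uo [c Uc <-]; rewrite bigcap_mkord.
have cfi i : continuous (iter i f).
  elim: i => [|i IH] x /=; first exact: cvg_id.
  by apply: continuous_comp; [exact: IH|exact: cf].
elim/big_ind: _ => [|B C|i _]; [exact: openT|exact: openI|].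
by have /continuousP := cfi i; apply; apply/Uo/Uc.
Qed.

Lemma compact_cover_compact (X : topologicalType) :
  compact [set: X] -> cover_compact [set: X].
Proof.
(* [compact_cover] concerns pointed spaces: a nonempty [X] receives the point [x], and an empty one
   is covered by the empty subfamily. *)
case: (pselect (exists x : X, True)) => [[x _]|X0].
  pose p := isPointed.Build X x.
  pose X' : ptopologicalType := HB.pack X p.
  by have -> : @compact X = @cover_compact X by exact: (@compact_cover X').
move=> _ I D F _ _; exists fset0; first by move=> i; rewrite in_fset0.
by move=> x; exfalso; apply: X0; exists x.
Qed.

Lemma min_subcover_le_size (R : realType) (X : Type) (U : set (set X))
    (s : seq (set X)) :
  (forall A, A \in s -> U A) -> (forall x, exists2 A, A \in s & A x) ->
  min_subcover R U <= (size s)%:R%:E.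
Proof.
move=> sU sX; pose F := seq_fset tt s.
(* The cardinality is that of a set of sets, so repetitions in [s] are counted once. *)
apply: ge_ereal_inf; exists (size (undup s))%:R%:E; last first.
  by rewrite lee_fin ler_nat size_undup.
exists (size (undup s)) => //; exists [set` F]; split.
- by move=> A /=; rewrite seq_fsetE; exact: sU.
- exact/card_eq_fsetP/size_seq_fset.
- apply/seteqP; split=> // x _; have [A As Ax] := sX x.
  by exists A => //=; rewrite seq_fsetE.
Qed.

(* Kraft-type counting, by induction on [N]: [A i] is covered by sets of the
   form [A i `&` iter (n i) f @^-1` B], where [B] ranges over the subcover
   obtained for [N - n i]. *)
Lemma join_iter_subcover (R : realType) (X : Type) (f : X -> X)
    (U : set (set X)) (m M : nat) (A : nat -> set X) (n : nat -> nat) (q : R) :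
  (0 < q <= 1)%R ->
  (forall i, (i < m)%N -> join_iter f U (n i) (A i)) ->
  (forall i, (i < m)%N -> (0 < n i <= M)%N) ->
  (forall x, exists2 i, (i < m)%N & A i x) ->
  (\sum_(0 <= i < m) q ^+ n i <= 1)%R ->
  forall N, exists s : seq (set X),
    [/\ forall B, B \in s -> join_iter f U N B,
        forall x, exists2 B, B \in s & B x &
        ((size s)%:R * q ^+ (N + M) <= 1)%R].
Proof.
move=> /andP[q0 q1] AU nM AX qn N.
elim/ltn_ind: N => N IH.
have /choice[s sP] : forall i, exists s : seq (set X), (i < m)%N ->
    [/\ forall B, B \in s -> join_iter f U N B,
        forall x, A i x -> exists2 B, B \in s & B x &
        ((size s)%:R * q ^+ (N + M) <= q ^+ n i)%R].
  move=> i; case: (ltnP i m) => [im|_]; last by exists [::].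
  have /andP[ni0 niM] := nM _ im.
  case: (leqP N (n i)) => [Nni|niN].
    have [B BN AB] := subset_join_iter Nni (AU _ im).
    exists [:: B] => _; split=> [C|x Ax|]; first by rewrite inE => /eqP ->.
      by exists B; [rewrite inE|exact: AB].
    (* Here [N <= n i] and one set suffices. The exponent [N + M], rather than [N], makes its weight
       at most [q ^+ n i], since [n i <= M]. *)
    rewrite mul1r; apply: ler_wiXn2l; rewrite ?(ltW q0) //=.
    by rewrite (leq_trans niM) ?leq_addl.
  have [|s [sU sX sq]] := IH (N - n i)%N.
    by rewrite ltn_subrL ni0 (leq_ltn_trans _ niN).
  exists [seq A i `&` iter (n i) f @^-1` B | B <- s] => _; split.
  - move=> _ /mapP[B Bs ->]; rewrite -(subnKC (ltnW niN)).
    by apply: join_iterD; [exact: AU|exact: sU].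
  - move=> x Ax; have [B Bs Bx] := sX (iter (n i) f x).
    by exists (A i `&` iter (n i) f @^-1` B) => //; apply/mapP; exists B.
  - rewrite size_map -{1}(subnK (ltnW niN)) -addnAC exprD mulrA.
    by rewrite ler_piMl // exprn_ge0 // ltW.
exists (flatten [seq s i | i <- iota 0 m]); split.
- move=> B /flatten_mapP[i]; rewrite mem_iota add0n => /= im Bs.
  by have [sU _ _] := sP i im; exact: sU.
- move=> x; have [i im Ax] := AX x; have [_ sX _] := sP i im.
  have [B Bs Bx] := sX x Ax; exists B => //.
  by apply/flatten_mapP; exists i => //; rewrite mem_iota.
- apply: le_trans qn; rewrite size_flatten sumnE /shape -map_comp big_map.
  rewrite natr_sum mulr_suml /index_iota subn0 !big_seq; apply: ler_sum => i.
  by rewrite mem_iota add0n => /= im; have [] := sP i im.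
Qed.

(** * Entropy of a cover from exponential bounds on subcovers *)

Lemma le_logp (R : realType) (x y : \bar R) : x <= y -> logp x <= logp y.
Proof.
rewrite /logp => xy; case: (leP x 0) => [x0|x0].
  by rewrite (le0_lneNy x0) maxNye le_max lexx orbT.
apply: le_max2 => //; rewrite lee_lne ?in_itv //= ?leey ?andbT ?ltW //.
exact: lt_le_trans xy.
Qed.

(** The shift [M] disappears in the limit, because [M * a / n] tends to 0. *)
Lemma cover_entropy_le (R : realType) (X : Type) (f : X -> X)
    (U : set (set X)) (M : nat) (a : R) :
  (0 <= a)%R ->
  (forall N, min_subcover R (join_iter f U N) <= (expR ((N + M)%:R * a))%:E) ->
  cover_entropy R f U <= a%:E.
Proof.
move=> a0 Ua; apply/lee_addgt0Pr => e e0.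
(* From [N0] on, [M * a / n <= e]. The upper limit is an infimum of suprema over neighbourhoods of
   infinity, so this single tail bounds it. *)
pose N0 := (Num.truncn (M%:R * a / e)).+1.
apply: ge_ereal_inf; exists (ereal_sup [set ((n%:R)^-1)%:E *
    logp (min_subcover R (join_iter f U n)) | n in [set n | (N0 <= n)%N]]).
  by exists [set n | (N0 <= n)%N] => //; exists N0.
apply: ge_ereal_sup => _ [n /= N0n <-].
have n0 : (0 < n%:R :> R)%R by rewrite ltr0n (leq_trans _ N0n).
have := le_logp (Ua n); rewrite {2}/logp lne_EFin ?expR_gt0 // expRK.
rewrite max_l ?lee_fin ?mulr_ge0 // => /(lee_wpmul2l _).
move=> /(_ (n%:R^-1)%:E); rewrite lee_fin invr_ge0 ltW // => /(_ isT).
move=> /le_trans; apply.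
rewrite -EFinM lee_fin ler_pdivrMl // natrD mulrDl mulrDr lerD2l.
rewrite -ler_pdivrMr //; apply/ltW/(lt_le_trans (truncnS_gt _)).
by rewrite ler_nat.
Qed.

(** * Metric estimates: Lebesgue number, diameters, Lipschitz iterates *)

Lemma Lebesgue_number (R : realType) (X : topologicalType) (d : X -> X -> R)
    (U : set (set X)) :
  compact [set: X] -> compatible_metric d -> open_covering U ->
  exists2 e : R, (0 < e)%R &
    forall x, exists2 A, U A & forall y, (d x y < e)%R -> A y.
Proof.
move=> Xc [[d_ge0 d_eq0 dC d_tri] dopen] [Uo Ucov].
(* The doubled radius leaves room for the triangle inequality: a point within [r i] of a centre [i]
   still has its own [r i]-ball inside the chosen element. *)
have /choice[r rP] : forall x, exists r : R, (0 < r)%R /\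
    exists2 A, U A & forall y, (d x y < r + r)%R -> A y.
  move=> x; have [A UA Ax] : (\bigcup_(A in U) A) x by rewrite Ucov.
  have [e e0 eA] := (dopen A).1 (Uo _ UA) x Ax.
  exists (e / 2)%R; split; first by rewrite divr_gt0.
  by exists A => // y; rewrite -splitr; exact: eA.
have ball_open x : open [set y | (d x y < r x)%R].
  apply/dopen => y /= xy; exists (r x - d x y)%R; first by rewrite subr_gt0.
  by move=> z yz; rewrite (le_lt_trans (d_tri x y z))// -ltrBrDl.
have [|F _ FX] := compact_cover_compact Xc (fun x (_ : [set: X] x) => ball_open x).
  by move=> x _; exists x => //=; rewrite (d_eq0 x x).2 //; have [] := rP x.
(* The value 1 keeps the minimum positive and defined when [F] is empty. *)
exists (\big[Order.min/1%R]_(i <- F) r i)%R.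
  by elim/big_ind: _ => [|x y x0 y0|i _]; rewrite ?lt_min ?x0 //; have [] := rP i.
move=> x; have [i /= iF ix] := FX x I; have [_ [A UA iA]] := rP i.
exists A => // y xy; apply: iA; rewrite (le_lt_trans (d_tri i x y))// ltrD//.
by apply: lt_le_trans xy _; exact: ge_bigmin_seq.
Qed.

Lemma le_diam (R : realType) (X : Type) (d : X -> X -> R) (E : set X) (x y : X) :
  E x -> E y -> (d x y)%:E <= diam d E.
Proof.
move=> Ex Ey; rewrite /diam le_max; apply/orP; right.
by apply: ereal_sup_ubound; exists (x, y).
Qed.

Lemma diam_pow_ge0 (R : realType) (X : Type) (d : X -> X -> R) (s : R)
    (E : set X) : 0 <= diam_pow d s E.
Proof. by rewrite /diam_pow; case: ifP => // _; exact: poweR_ge0. Qed.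

Lemma Lip_bound (R : realType) (X : Type) (d : X -> X -> R) (f : X -> X) (L : R) :
  is_metric d -> Lip d f <= L%:E ->
  forall i x y, (d (iter i f x) (iter i f y) <= L ^+ i * d x y)%R.
Proof.
move=> [d_ge0 d_eq0 _ _]; rewrite /Lip ge_max lee_fin => /andP[L0 LipL].
have fL x y : (d (f x) (f y) <= L * d x y)%R.
  case: (eqVneq (d x y) 0%R) => [/d_eq0 ->|xy].
    by rewrite (d_eq0 (f y) (f y)).2 // mulr_ge0.
  have xy0 : (0 < d x y)%R by rewrite lt_neqAle eq_sym xy d_ge0.
  rewrite -ler_pdivrMr // -lee_fin; apply: le_trans LipL.
  by apply: ereal_sup_ubound; exists (x, y).
elim=> [|i IH] x y /=; first by rewrite mul1r.
by rewrite (le_trans (fL _ _))// exprS -mulrA ler_wpM2l.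
Qed.

(** With [c = e / rho], this finds the last time [n] at which the radius [rho], multiplied by [L] at
    each step, is still below [e]. *)
Lemma expr_bracket (R : realType) (L c : R) : (1 < L)%R -> (1 < c)%R ->
  exists n, (L ^+ n < c <= L ^+ n.+1)%R.
Proof.
move=> L1 c1; have L0 : (0 < L)%R := lt_trans ltr01 L1.
have exk : exists k, (c <= L ^+ k)%R.
  exists (Num.truncn (ln c / ln L)).+1.
  rewrite -ler_ln ?posrE ?exprn_gt0 ?(lt_trans _ c1)// lnXn // -mulr_natl.
  by rewrite -ler_pdivrMr ?ln_gt0 // ltW // truncnS_gt.
case: (ex_minnP exk) => -[|n]; first by rewrite expr0 leNgt c1.
move=> cn n_min; exists n; rewrite cn andbT ltNge.
by apply/negP => /n_min; rewrite ltnn.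
Qed.

(** * Small sets inside elements of iterated joins *)

Section variable_length_cover.
Context (R : realType) (X : topologicalType) (d : X -> X -> R) (f : X -> X).
Context (U : set (set X)) (e L s : R).
Context (d_metric : is_metric d) (e0 : (0 < e)%R) (L1 : (1 < L)%R).
Context (eU : forall x, exists2 A, U A & forall y, (d x y < e)%R -> A y).
Context (LipL : Lip d f <= L%:E) (s0 : (0 < s)%R).

(** The number [expR (- (s * ln L))] is [L] to the power [- s]. With
    [L ^+ n < e / rho <= L ^+ n.+1], the first inequality keeps [E] within [e] of the orbit of [x]
    at times 0 to [n], hence a join of order [n.+1]; the second bounds the weight. *)
Lemma ball_sub_join_iter (E : set X) (x : X) (rho : R) :
  (0 < rho < e)%R -> (forall y, E y -> (d x y <= rho)%R) ->
  exists n A, [/\ (0 < n)%N, join_iter f U n A, E `<=` A &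
    (expR (- (s * ln L)) ^+ n <= (rho / e) `^ s)%R].
Proof.
move=> /andP[rho0 rhoe] Erho.
have [n /andP[Lne eLn]] : exists n, (L ^+ n < e / rho <= L ^+ n.+1)%R.
  by apply: expr_bracket => //; rewrite ltr_pdivlMr // mul1r.
have /choice[A AP] : forall i, exists A, U A /\
    forall y, (d (iter i f x) y < e)%R -> A y.
  by move=> i; have [A UA iA] := eU (iter i f x); exists A.
exists n.+1, (\bigcap_(i in `I_n.+1) (iter i f @^-1` (A i))); split => //.
- by exists A => // i _; have [] := AP i.
- move=> y Ey i /=; rewrite ltnS => ni; have [_] := AP i; apply.
  apply: (le_lt_trans (Lip_bound d_metric LipL i x y)).
  apply: (@le_lt_trans _ _ (L ^+ n * rho)%R); last by rewrite -ltr_pdivlMr.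
  have L0 : (0 <= L)%R by rewrite (le_trans ler01) ?ltW.
  have [d_ge0 _ _ _] := d_metric; apply: ler_pM => //; first exact: exprn_ge0.
    by apply: ler_weXn2l => //; exact: ltW.
  exact: Erho.
- rewrite -expRM_natl /powR gt_eqF ?divr_gt0 // ler_expR.
  rewrite mulrN mulrCA -mulrN ler_pM2l // lerNl -lnV ?posrE ?divr_gt0 //.
  rewrite invf_div mulr_natl -lnXn ?(lt_trans ltr01)// ler_ln ?posrE ?divr_gt0//.
  by rewrite exprn_gt0 // (lt_trans ltr01).
Qed.

(** A set of diameter 0 stays small at all times, so there is no last time to choose. It is given a
    positive radius instead, and the slack [t] pays for this. *)
Lemma small_set_sub_join_iter (E : set X) (t : R) (x0 : X) :
  (0 < t)%R -> diam d E <= (e / 2)%:E ->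
  exists n A, [/\ (0 < n)%N, join_iter f U n A, E `<=` A &
    (expR (- (s * ln L)) ^+ n)%:E <= (e `^ (- s))%:E * diam_pow d s E + t%:E].
Proof.
move=> t0 Ee.
have eU0 : 0 <= (e `^ (- s))%:E * diam_pow d s E.
  by rewrite mule_ge0 ?diam_pow_ge0 // lee_fin powR_ge0.
have small x : (forall y, E y -> (d x y <= 0)%R) ->
    exists n A, [/\ (0 < n)%N, join_iter f U n A, E `<=` A &
      (expR (- (s * ln L)) ^+ n)%:E
        <= (e `^ (- s))%:E * diam_pow d s E + t%:E].
  move=> Ex; pose rho := Num.min (e / 2)%R (e * t `^ s^-1)%R.
  have rho0 : (0 < rho)%R by rewrite lt_min divr_gt0 // mulr_gt0 // powR_gt0.
  have [||n [A [n0 AU EA nt]]] := @ball_sub_join_iter E x rho.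
  - rewrite rho0 gt_min; apply/orP; left.
    by rewrite ltr_pdivrMr // ltr_pMr // ltr1n.
  - by move=> y /Ex /le_trans; apply; exact: ltW.
  exists n, A; split => //; rewrite -[leLHS]add0e leeD // lee_fin.
  apply: (le_trans nt); rewrite -[leRHS](powRr1 (ltW t0)).
  rewrite -(@mulVf _ s) ?gt_eqF // powRrM.
  apply: ge0_ler_powR; rewrite ?nnegrE ?powR_ge0 ?divr_ge0 //;
    rewrite ?(ltW rho0) ?(ltW e0) ?(ltW s0) //.
  by rewrite ler_pdivrMr // mulrC ge_min lexx orbT.
(* The empty set has no point of its own to serve as centre, so [x0] is taken. *)
case: (eqVneq E set0) => [E0|/set0P[x Ex]].
  by apply: (small x0) => y; rewrite E0.
have [r r0 dr] : exists2 r : R, (0 <= r)%R & diam d E = r%:E.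
  have : 0 <= diam d E by rewrite /diam le_max lexx.
  move: Ee; case: (diam d E) => // r _; rewrite lee_fin => r0; by exists r.
have Er y : E y -> (d x y <= r)%R.
  by move=> Ey; rewrite -lee_fin -dr; exact: le_diam.
have := r0; rewrite le_eqVlt => /predU1P[r00|rgt0].
  by apply: (small x); rewrite r00.
have [|n [A [n0 AU EA nt]]] := @ball_sub_join_iter E x r _ Er.
  rewrite rgt0 -lte_fin -dr (le_lt_trans Ee) // lte_fin.
  by rewrite ltr_pdivrMr // ltr_pMr // ltr1n.
exists n, A; split => //; rewrite -[leLHS]adde0 leeD ?lee_fin ?(ltW t0) //.
rewrite /diam_pow ifF; last by apply/negbTE/set0P; exists x.
rewrite dr poweR_EFin -EFinM lee_fin; apply: le_trans nt _.
rewrite (powRM _ r0) ?invr_ge0 ?(ltW e0) // -(powR_inv1 (ltW e0)).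
by rewrite -powRrM mulN1r mulrC.
Qed.
End variable_length_cover.

(** * Covers from vanishing Hausdorff measure, and the entropy bound *)

Lemma hausdorff_measure0_cover (R : realType) (X : Type) (d : X -> X -> R)
    (s delta c : R) :
  hausdorff_measure d s [set: X] = 0 -> (0 < delta)%R -> (0 < c)%R ->
  exists E : nat -> set X, [/\ forall x, exists i, E i x,
    forall i, diam d (E i) <= delta%:E &
    forall m, \sum_(0 <= i < m) diam_pow d s (E i) < c%:E].
Proof.
move=> Hs delta0 c0.
have /ereal_inf_lt[_ [E [EX Edelta] <-] Ec] :
    hausdorff_premeasure d s delta [set: X] < c%:E.
  apply: (@le_lt_trans _ _ 0); last by rewrite lte_fin.
  by rewrite -Hs; apply: ereal_sup_ubound; exists delta.
exists E; split => // [x|m]; first by have [i _ Ei] := EX x I; exists i.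
apply: le_lt_trans Ec; apply: nneseries_lim_ge => i _ _.
exact: diam_pow_ge0.
Qed.

(** This excludes [s = 0] on a nonempty space. In dimension 0 every nonempty set weighs 1, even a
    singleton, so no cover has partial sums below 1. *)
Lemma hausdorff_measure_dim0 (R : realType) (X : Type) (d : X -> X -> R) :
  hausdorff_measure d 0 [set: X] = 0 -> X -> False.
Proof.
move=> H0 x; have [E [EX _ Esum]] := hausdorff_measure0_cover H0 ltr01 ltr01.
have [i Ei] := EX x; have := Esum i.+1; rewrite big_nat_recr //=.
have -> : diam_pow d 0 (E i) = 1.
  rewrite /diam_pow ifF ?poweRe0 //.
  by apply/negbTE/set0P; exists x.
rewrite ltNge leeDr // sume_ge0 // => j _; exact: diam_pow_ge0.
Qed.

(** The terms are the slacks [t] granted to the successive sets of a countable cover. *)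
Lemma geometric_half_sum (R : realType) (m : nat) :
  (\sum_(0 <= i < m) 2^-1 ^+ i.+2 <= 2^-1 :> R)%R.
Proof.
suff -> : (\sum_(0 <= i < m) 2^-1 ^+ i.+2 = 2^-1 - 2^-1 ^+ m.+1 :> R)%R.
  by rewrite gerBl exprn_ge0.
elim: m => [|m IH]; first by rewrite big_geq // expr1 subrr.
rewrite big_nat_recr //= IH; rewrite !(exprS _ m.+1).
by set y := (_ ^+ m.+1)%R; lra.
Qed.

Lemma cover_entropy_le_hausdorff (R : realType) (X : topologicalType)
    (d : X -> X -> R) (f : X -> X) (U : set (set X)) (s L : R) :
  compact [set: X] -> compatible_metric d -> continuous f -> open_covering U ->
  (0 <= s)%R -> hausdorff_measure d s [set: X] = 0 ->
  (1 < L)%R -> Lip d f <= L%:E ->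
  cover_entropy R f U <= (s * ln L)%:E.
Proof.
move=> Xc dX cf UX s0 Hs L1 LipL.
have lam0 : (0 <= s * ln L)%R by rewrite mulr_ge0 // ltW // ln_gt0.
have [[x0 _]|X0] := pselect (exists x : X, True); last first.
  (* On the empty space the empty list is a subcover, and the shift is 0. *)
  apply: (@cover_entropy_le _ _ _ _ 0) => // N.
  apply: (@le_trans _ _ (size ([::] : seq (set X)))%:R%:E).
    apply: min_subcover_le_size => // x; by exfalso; apply: X0; exists x.
  by rewrite lee_fin expR_ge0.
have {s0 lam0} [s0 lam0] : (0 < s)%R /\ (0 <= s * ln L)%R.
  split => //; rewrite lt_neqAle s0 andbT; apply/eqP => s00.
  by rewrite -s00 in Hs; exact: (hausdorff_measure_dim0 Hs x0).
have [e e0 eU] := Lebesgue_number Xc dX UX.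
have e20 : (0 < e / 2)%R by rewrite divr_gt0.
have c0 : (0 < e `^ s / 2)%R by rewrite divr_gt0 // powR_gt0.
have [E [EX Ee Ec]] := hausdorff_measure0_cover Hs e20 c0.
pose q := expR (- (s * ln L)).
have /choice[n /choice[A nA]] : forall i, exists n A, [/\ (0 < n)%N,
    join_iter f U n A, E i `<=` A & (q ^+ n)%:E
      <= (e `^ (- s))%:E * diam_pow d s (E i) + (2^-1 ^+ i.+2)%:E].
  by move=> i; apply: small_set_sub_join_iter => //; case: dX.
have Aopen i : open (A i).
  by have [_ AU _ _] := nA i; apply: join_iter_open AU => //; case: UX.
(* The sets [E i] are arbitrary, so compactness is applied to the open sets [A i] that contain
   them. *)
have [|F _ FX] := compact_cover_compact Xc (fun i (_ : [set: nat] i) => Aopen i).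
  move=> x _; have [i Ei] := EX x; have [_ _ EA _] := nA i.
  by exists i => //; exact: EA.
(* The finite set [F] is enlarged to the initial segment below [m]; the bound [Ec] holds for every
   partial sum, so it covers this one. *)
pose m := (\max_(i <- F) i).+1; pose M := (\max_(i < m) n i)%N.
have subc := @join_iter_subcover R X f U m M A n q.
apply: (@cover_entropy_le _ _ _ _ M) => // N.
have [|i im|i im|x||sq [sqU sqX sqq]] := subc _ _ _ _ _ N.
- by rewrite expR_gt0 -expR0 ler_expR lerNl oppr0.
- by have [] := nA i.
- have [-> _ _ _] := nA i => /=.
  exact: (@leq_bigmax _ (fun i : 'I_m => n i) (Ordinal im)).
- have [i /= iF ix] := FX x I; exists i => //.
  by rewrite ltnS; apply: leq_bigmax_seq.
- rewrite -lee_fin -sumEFin.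
  apply: (@le_trans _ _ (\sum_(0 <= i < m) ((e `^ (- s))%:E * diam_pow d s (E i)
    + (2^-1 ^+ i.+2)%:E))); first by apply: lee_sum => i _; have [] := nA i.
  rewrite big_split /= -ge0_sume_distrr; last by move=> i _; exact: diam_pow_ge0.
  apply: (@le_trans _ _ (e `^ (- s) * (e `^ s / 2) + 2^-1)%:E); last first.
    by rewrite powRN mulrA mulVf ?gt_eqF ?powR_gt0 // lee_fin; lra.
  rewrite EFinD EFinM leeD // ?lee_wpmul2l ?lee_fin ?powR_ge0 ?(ltW (Ec m)) //.
  by rewrite sumEFin lee_fin geometric_half_sum.
apply: le_trans (min_subcover_le_size R sqU sqX) _; rewrite lee_fin.
move: sqq; rewrite /q -expRM_natl mulrN expRN -ler_pdivlMr ?invr_gt0 ?expR_gt0 //.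
by rewrite invrK mul1r.
Qed.

(** * Passage from admissible exponents to the dimension and the Lipschitz constant *)

Lemma logp_ge0 (R : realType) (x : \bar R) : 0 <= logp x.
Proof. by rewrite /logp le_max lexx orbT. Qed.

Lemma le_expR_logp (R : realType) (x : \bar R) (a : R) :
  logp x <= a%:E -> x <= (expR a)%:E.
Proof.
rewrite /logp ge_max => /andP[xa _].
case: x xa => [x| |] //=; last by move=> _; rewrite leNye.
case: (leP x 0%R) => [x0 _|x0]; first by rewrite lee_fin (le_trans x0) ?expR_ge0.
by rewrite !lee_fin -ler_expR lnK ?posrE.
Qed.

Lemma hausdorff_dim_ge0 (R : realType) (X : Type) (d : X -> X -> R) (A : set X) :
  0 <= hausdorff_dim d A.
Proof. by apply: le_ereal_inf_tmp => _ [s [s0 _] <-]; rewrite lee_fin. Qed.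

(** Only the case of two finite factors [r] and [l] has content. Both are approached from above, by
    an exponent [s < r + t] of zero measure and by [L = expR (l + t)], which exceeds 1 even if
    [l = 0]. *)
Lemma cover_entropy_le_dim_Lip (R : realType) (X : topologicalType)
    (d : X -> X -> R) (f : X -> X) (U : set (set X)) :
  compact [set: X] -> compatible_metric d -> continuous f -> open_covering U ->
  cover_entropy R f U <= mul_infty (hausdorff_dim d [set: X]) (logp (Lip d f)).
Proof.
move=> Xc dX cf UX; rewrite /mul_infty; case: ifPn => [_|]; first exact: leey.
rewrite negb_or => /andP[].
have := hausdorff_dim_ge0 d [set: X].
case Dr : (hausdorff_dim d [set: X]) => [r| |] //; rewrite lee_fin => r0 _.
have := logp_ge0 (Lip d f).
case lE : (logp (Lip d f)) => [l| |] //; rewrite lee_fin => l0 _.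
apply/lee_addgt0Pr => e e0; rewrite -EFinM -EFinD.
have rl : (0 < r + l + 1)%R by lra.
(* As [t <= 1], the product [(r + t) * (l + t)] is at most [r * l + t * (r + l + 1)], hence at most
   [r * l + e]. *)
pose t := Num.min 1%R (e / (r + l + 1))%R.
have t0 : (0 < t)%R by rewrite lt_min ltr01 divr_gt0.
have te : (t * (r + l + 1) <= e)%R by rewrite -ler_pdivlMr // ge_min lexx orbT.
have t1 : (t <= 1)%R by rewrite ge_min lexx.
have : hausdorff_dim d [set: X] < (r + t)%:E by rewrite Dr lte_fin ltrDl.
move=> /ereal_inf_lt[_ [s [s0 Hs] <-]]; rewrite lte_fin => srt.
have lt0 : (0 < l + t)%R by rewrite ltr_wpDl.
have Le : Lip d f <= (expR (l + t))%:E.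
  by apply: le_expR_logp; rewrite lE lee_fin lerDl ltW.
have L1 : (1 < expR (l + t))%R by rewrite expR_gt1.
apply: le_trans (cover_entropy_le_hausdorff Xc dX cf UX s0 Hs L1 Le) _.
rewrite expRK lee_fin (@le_trans _ _ ((r + t) * (l + t))%R) //.
  by rewrite ler_wpM2r ?ltW.
have tt : (t * t <= t)%R by rewrite ler_piMr // ltW.
lra.
Qed.

(** * Invariance under topological conjugacy *)

Section conjugacy.
Context (R : realType) (X Y : topologicalType) (psi : X -> Y) (phi : Y -> X).
Context (psiK : cancel psi phi) (phiK : cancel phi psi).
Context (d : Y -> Y -> R).
Let dpsi (x y : X) := d (psi x) (psi y).

Lemma compatible_metric_pullback :
  continuous psi -> continuous phi -> compatible_metric d ->
  compatible_metric dpsi.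
Proof.
move=> /continuousP cpsi /continuousP cphi [[d_ge0 d_eq0 dC d_tri] dopen].
split.
  split=> [x y|x y|x y|x y z]; rewrite /dpsi //.
  by rewrite d_eq0; split=> [/(can_inj psiK)|->].
move=> A; split=> [Ao x Ax|Aball].
  have [|e e0 eA] := (dopen (phi @^-1` A)).1 (cphi _ Ao) (psi x).
    by rewrite /= psiK.
  by exists e => // y /eA; rewrite /= psiK.
have -> : A = psi @^-1` (phi @^-1` A) by apply/funext => x; rewrite /= psiK.
apply/cpsi/dopen => y /Aball[e e0 eA]; exists e => // z yz.
by apply: eA; rewrite /dpsi !phiK.
Qed.

Lemma Lip_pullback (f : X -> X) (g : Y -> Y) :
  g \o psi = psi \o f -> Lip dpsi f = Lip d g.
Proof.
move=> gf; have gfE x : g (psi x) = psi (f x) := congr1 (fun h => h x) gf.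
rewrite /Lip; congr (maxe _ (ereal_sup _)); apply/seteqP; split=> z /=.
  move=> [[x y] /= xy <-]; exists (psi x, psi y) => //=.
  by rewrite !gfE.
move=> [[x y] /= xy <-]; exists (phi x, phi y); rewrite /dpsi /= -?gfE !phiK//.
Qed.

Lemma diam_pullback (E : set Y) : diam dpsi (psi @^-1` E) = diam d E.
Proof.
rewrite /diam; congr (maxe _ (ereal_sup _)); apply/seteqP; split=> z /=.
  by move=> [[x y] /= xy <-]; exists (psi x, psi y).
by move=> [[x y] /= xy <-]; exists (phi x, phi y); rewrite /dpsi /= !phiK.
Qed.

Lemma diam_pow_pullback (s : R) (E : set Y) :
  diam_pow dpsi s (psi @^-1` E) = diam_pow d s E.
Proof.
rewrite /diam_pow diam_pullback; congr (if _ then _ else _).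
(* [diam_pow] treats the empty set apart, so equal diameters are not enough: emptiness must be
   transferred too, by surjectivity of [psi]. *)
apply/eqP/eqP => [E0|->]; last exact: preimage_set0.
apply/seteqP; split=> // y Ey.
by have : (psi @^-1` E) (phi y) by [rewrite /= phiK]; rewrite E0.
Qed.

(** Preimages under [psi] and [phi] match the covers of the two spaces, preserving diameters and
    weights. *)
Lemma hausdorff_premeasure_pullback (s delta : R) :
  hausdorff_premeasure dpsi s delta [set: X] =
  hausdorff_premeasure d s delta [set: Y].
Proof.
congr ereal_inf; apply/seteqP; split=> z /= [E [EX Ed] <-].
  have EE i : E i = psi @^-1` (phi @^-1` E i) by apply/funext => x; rewrite /= psiK.
  exists (fun i => phi @^-1` E i).
    split=> [y _|i]; last by rewrite -diam_pullback -EE.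
    by have [i _ Ei] := EX (phi y) I; exists i.
  by apply: eq_eseriesr => i _; rewrite -diam_pow_pullback -EE.
exists (fun i => psi @^-1` E i).
  split=> [x _|i]; last by rewrite diam_pullback.
  by have [i _ Ei] := EX (psi x) I; exists i.
apply: eq_eseriesr => i _; exact: diam_pow_pullback.
Qed.

Lemma hausdorff_dim_pullback :
  hausdorff_dim dpsi [set: X] = hausdorff_dim d [set: Y].
Proof.
have Hs s : hausdorff_measure dpsi s [set: X] = hausdorff_measure d s [set: Y].
  by congr ereal_sup; apply: eq_imagel => delta _;
    exact: hausdorff_premeasure_pullback.
congr ereal_inf; apply/seteqP; split=> _ [s [s0 sH] <-]; exists s => //;
  by split=> //; rewrite -sH Hs.
Qed.
End conjugacy.

(** Each metric on [Y] pulls back to one on [X] with the same product. Equality then follows by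
    exchanging the roles of [psi] and [phi]. *)
Lemma HausLip_le_conjugate (R : realType) (X Y : topologicalType) (f : X -> X)
    (g : Y -> Y) (psi : X -> Y) (phi : Y -> X) :
  cancel psi phi -> cancel phi psi -> continuous psi -> continuous phi ->
  g \o psi = psi \o f -> HausLip R f <= HausLip R g.
Proof.
move=> psiK phiK cpsi cphi gf; apply: le_ereal_inf_tmp => _ [d dY <-].
apply: ereal_inf_lbound; exists (fun x y => d (psi x) (psi y)).
  exact: (compatible_metric_pullback psiK phiK cpsi cphi dY).
by rewrite (hausdorff_dim_pullback psiK phiK) (Lip_pullback phiK d gf).
Qed.

Theorem lemma2 (R : realType) :
  (forall (X Y : topologicalType) (f : X -> X) (g : Y -> Y) (psi : X -> Y),
     compact [set: X] -> metrizable R X ->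
     compact [set: Y] -> metrizable R Y ->
     continuous f -> continuous g ->
     homeomorphism psi -> g \o psi = psi \o f ->
     HausLip R f = HausLip R g)
  /\
  (forall (X : topologicalType) (f : X -> X),
     compact [set: X] -> metrizable R X -> continuous f ->
     top_entropy R f <= HausLip R f).
Proof.
split=> [X Y f g psi _ _ _ _ _ _ [cpsi [phi [psiK phiK cphi]]] gf|X f Xc _ cf].
  apply/eqP; rewrite eq_le (HausLip_le_conjugate R psiK phiK cpsi cphi gf) /=.
  apply: (HausLip_le_conjugate R phiK psiK cphi cpsi).
  (* The inverse [phi] conjugates [g] to [f]: both sides agree after applying [psi], which is
     injective. *)
  apply/funext => y /=; apply: (can_inj psiK); rewrite phiK.
  by have := congr1 (fun h => h (phi y)) gf; rewrite /= phiK.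
apply: ge_ereal_sup => _ [U UX <-]; apply: le_ereal_inf_tmp => _ [d dX <-].
exact: cover_entropy_le_dim_Lip.
Qed.
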